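(* For any $q\in(0,1/3]$ there is a finite set $\Sigma\subset\mathbb{R}$ with exactly $4+\lceil 1/q^2\rceil$ elements such that the set $N_q$ is the attractor of the iterated function system on $\mathbb{R}$ consisting of the $4+\lceil 1/q^{2}\rceil$ affine functions $$f_\sigma(x)=q^2x+\sigma,\qquad \sigma\in\Sigma.$$
   Context: $\lceil\alpha\rceil$ denotes the smallest integer greater than or equal to $\alpha$. $\mathbb{N}=\{1,2,3,\dots\}$. For $q\in(0,1/2)$, sets $U_n^q$ ($n\ge1$) are defined by the usual Cantor construction: start with the interval $[0,1]$; at the $n$-th step there are $2^{n-1}$ disjoint closed intervals of length $q^{n-1}$, and from each of them one removes the concentric open middle interval of length $q^{n-1}(1-2q)$, leaving $2^n$ closed intervals of length $q^n$. $U_n^q$ denotes the union of the $2^{n-1}$ open intervals removed at the $n$-th step. Put $N_q=[0,1]\setminus\bigcup_{n\in\mathbb{N}}U_{2n}^q$. An iterated function system (IFS) on a complete metric space $X$ is a finite sequence $\mathcal{S}=(f_1,\dots,f_m)$ of functions $f_i:X\to X$ with Lipschitz constants strictly smaller than $1$. Its attractor is the unique nonempty compact set $D_0\subset X$ with $D_0=f_1(D_0)\cup\dots\cup f_m(D_0)$. *)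

(* Defs.v *)
From HB Require Import structures.
From mathcomp Require Import all_boot all_order all_algebra finmap.
From mathcomp Require Import all_classical all_reals all_analysis.
Set Implicit Arguments.
Unset Strict Implicit.
Unset Printing Implicit Defensive.
Import Order.TTheory GRing.Theory Num.Theory numFieldNormedType.Exports.
Local Open Scope classical_set_scope.
Local Open Scope ring_scope.

(* An interval is represented by the pair of its endpoints. [middle l J] is
   the interval of length [l] concentric with [J]. *)
Definition middle {R : realType} (l : R) (J : R * R) : R * R :=
  ((J.1 + J.2) / 2 - l / 2, (J.1 + J.2) / 2 + l / 2).

(* Length of the open intervals removed at step [n.+1] from the closed
   intervals of length [q ^+ n]. *)
Definition gap_length {R : realType} (q : R) (n : nat) : R :=
  q ^+ n * (1 - 2 * q).

(* The [2 ^ n] closed intervals left after [n] steps, from left to right. *)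
Fixpoint cantor_intervals {R : realType} (q : R) (n : nat) : seq (R * R) :=
  if n is m.+1 then
    flatten [seq [:: (J.1, (middle (gap_length q m) J).1);
                     ((middle (gap_length q m) J).2, J.2)]
            | J <- cantor_intervals q m]
  else [:: (0, 1)].

(* Steps are numbered from 1, so [cantor_removed q 0] is a junk value. *)
Definition cantor_removed {R : realType} (q : R) (n : nat) : set R :=
  \bigcup_(J in [set` cantor_intervals q n.-1])
     [set x | (middle (gap_length q n.-1) J).1 < x
              < (middle (gap_length q n.-1) J).2].

Definition Nset {R : realType} (q : R) : set R :=
  [set x | 0 <= x <= 1] `\`
  \bigcup_(n in [set n | (1 <= n)%N]) cantor_removed q (2 * n).

(* An iterated function system is a finite sequence of strict contractions.
   The default value [id] of [nth] is never reached. *)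
Definition is_ifs {R : realType} {X : metricType R} (S : seq (X -> X)) : Prop :=
  forall i, (i < size S)%N ->
    exists2 k : R, 0 <= k < 1 &
      forall x y, mdist (nth id S i x) (nth id S i y) <= k * mdist x y.

Definition ifs_invariant {R : realType} {X : metricType R}
    (S : seq (X -> X)) (D : set X) : Prop :=
  [/\ D !=set0, compact D & D = \bigcup_(i < size S) (nth id S i @` D)].

Definition is_attractor {R : realType} {X : metricType R}
    (S : seq (X -> X)) (D0 : set X) : Prop :=
  ifs_invariant S D0 /\ forall D, ifs_invariant S D -> D = D0.

(* The metric structure of the line is carried by the alias [R^o] of [R]. *)
Definition affine_ifs {R : realType} (q : R) (Sigma : {fset R}) :
    seq (R^o -> R^o) :=
  [seq (fun x : R => q ^+ 2 * x + s) | s <- enum_fset Sigma].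

(* Main.v *)
(* Write [N] for [Nset q].  The four corner intervals of length [q ^+ 2] left
   after two steps carry copies of [N], and the rest of [N] is the solid interval
   [[q, 1 - q]].  A copy of [N] scaled by [q ^+ 2] has a solid middle part of
   length [q ^+ 2 * (1 - 2 * q)], so [ceil (1 / q ^+ 2)] copies suffice to cover
   [[q, 1 - q]] by solid middle parts, starting exactly at [q] and ending exactly
   at [1 - q].  Only the first and the last of these copies stick out of
   [[q, 1 - q]], and they stay inside [N]: since [N] looks the same at its left
   and right ends, the protruding part falls on the end of a corner copy.  The
   other copies fit in [[q, 1 - q]] because [q <= 1 / 3] makes a solid middle part
   at least as long as the protruding part, [q ^+ 3]. *)
Require Import Defs.
From HB Require Import structures.
From mathcomp Require Import all_boot all_order all_algebra finmap.
From mathcomp Require Import all_classical all_reals all_analysis.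
From mathcomp Require Import zify ring lra.
Import Order.TTheory GRing.Theory Num.Theory numFieldNormedType.Exports.
Set Implicit Arguments.
Unset Strict Implicit.
Unset Printing Implicit Defensive.
Local Open Scope classical_set_scope.
Local Open Scope ring_scope.

(** * Self-similarity of the Cantor construction *)

Definition affine_pair {R : realType} (k s : R) (J : R * R) : R * R :=
  (k * J.1 + s, k * J.2 + s).

Lemma middle_affine_pair {R : realType} (q s : R) n (J : R * R) :
  middle (gap_length q n.+1) (affine_pair q s J) =
  affine_pair q s (middle (gap_length q n) J).
Proof.
rewrite /middle /affine_pair /gap_length /= exprS.
by congr pair; field.
Qed.

(** The definition subdivides at the last step; this recursion splits at the first step instead. The
    two agree because subdividing commutes with the affine maps of ratio [q]. *)
Lemma cantor_intervalsS {R : realType} (q : R) n :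
  cantor_intervals q n.+1 =
  [seq affine_pair q 0 J | J <- cantor_intervals q n] ++
  [seq affine_pair q (1 - q) J | J <- cantor_intervals q n].
Proof.
pose children n (J : R * R) := [:: (J.1, (middle (gap_length q n) J).1);
                                   ((middle (gap_length q n) J).2, J.2)].
have childrenS s m J : children m.+1 (affine_pair q s J) =
    [seq affine_pair q s K | K <- children m J].
  rewrite /children middle_affine_pair.
  by case: J (middle _ _) => [a b] [c d].
have intervalsS m : cantor_intervals q m.+1 =
    flatten [seq children m J | J <- cantor_intervals q m] by [].
elim: n => [|n IH].
  rewrite /= /middle /affine_pair /gap_length /= expr0.
  by congr [:: (_, _); (_, _)]; field.
rewrite intervalsS {1}IH map_cat flatten_cat (intervalsS n) !map_flatten.
rewrite -!map_comp; congr (flatten _ ++ flatten _); apply: eq_map => J;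
  exact: childrenS.
Qed.

Lemma cantor_removed1 {R : realType} (q x : R) :
  cantor_removed q 1 x <-> q < x < 1 - q.
Proof.
have -> : cantor_removed q 1 =
    [set x | (middle (gap_length q 0) (0, 1)).1 < x
              < (middle (gap_length q 0) (0, 1)).2].
  by rewrite /cantor_removed /=; apply/seteqP; split => [y [J /=]|y yJ];
    [rewrite inE => /eqP -> | exists (0, 1) => //=; rewrite inE].
rewrite /middle /gap_length expr0 /=.
by split => /andP[? ?]; apply/andP; split; lra.
Qed.

(** The index starts at [n.+2] because step 1 removes the central gap, which is not a copy of an
    earlier step. *)
Lemma cantor_removedS {R : realType} (q x : R) n : 0 < q ->
  cantor_removed q n.+2 x <->
  cantor_removed q n.+1 (x / q) \/ cantor_removed q n.+1 ((x - (1 - q)) / q).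
Proof.
move=> q0.
have removedP m y : cantor_removed q m.+1 y <->
    exists2 J, J \in cantor_intervals q m &
      (middle (gap_length q m) J).1 < y < (middle (gap_length q m) J).2 by [].
rewrite !removedP cantor_intervalsS; split=> [[J]|].
  rewrite mem_cat => /orP[] /mapP[K Kn ->];
  rewrite middle_affine_pair => h; [left|right];
  exists K => //; rewrite ltr_pdivlMr// ltr_pdivrMr//;
  move: (middle _ K) h => I; rewrite /affine_pair /=; lra.
case=> -[K Kn]; rewrite ltr_pdivlMr// ltr_pdivrMr// => h.
  exists (affine_pair q 0 K); last first.
    by rewrite middle_affine_pair /affine_pair; move: (middle _ K) h => I /=; lra.
  by rewrite mem_cat map_f.
exists (affine_pair q (1 - q) K); last first.
  by rewrite middle_affine_pair /affine_pair; move: (middle _ K) h => I /=; lra.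
by rewrite mem_cat [X in _ || X]map_f// orbT.
Qed.

Lemma cantor_removed_itv {R : realType} (q x : R) n : 0 < q < 1 ->
  cantor_removed q n.+1 x -> 0 < x < 1.
Proof.
move=> /andP[q0 q1]; elim: n x => [|n IH] x.
  by move=> /cantor_removed1; lra.
move=> /(cantor_removedS _ _ q0)[] /IH;
  rewrite ltr_pdivlMr// ltr_pdivrMr//; lra.
Qed.

(** * Even and odd steps, and the structure of [Nset] *)

(* The counterpart of [Nset] for the odd steps: each of the two sets is made of
   copies of the other one scaled by [q]. *)
Definition odd_Nset {R : realType} (q : R) : set R :=
  [set x | 0 <= x <= 1 /\ forall n, ~ cantor_removed q (2 * n).+1 x].

Lemma NsetE {R : realType} (q x : R) :
  Nset q x <-> 0 <= x <= 1 /\ forall n, ~ cantor_removed q (2 * n).+2 x.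
Proof.
split=> [[x01 h]|[x01 h]]; split=> //.
  by move=> n hn; apply: h; exists n.+1 => //=; rewrite mulnS.
by case=> -[//|n] _; rewrite mulnS => /h.
Qed.

Lemma mulr_itv {R : realType} (k y : R) :
  0 <= k -> 0 <= y <= 1 -> 0 <= k * y <= k.
Proof.
by move=> k0 /andP[? ?]; apply/andP; split; [exact: mulr_ge0|exact: ler_piMr].
Qed.

Lemma expr23_itv {R : realType} (q : R) : 0 < q -> q <= 1 / 3 ->
  0 < q ^+ 2 <= q / 3 /\ 0 < q ^+ 3 <= q ^+ 2 / 3.
Proof. by move=> q0 q3; split; rewrite exprn_gt0//= exprS; nra. Qed.

(** Since [q * y <= q], the right-hand alternative of [cantor_removedS] cannot occur; the left-hand
    one lowers the step by one, which turns even steps into odd ones. *)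
Lemma Nset_left {R : realType} (q y : R) : 0 < q -> q <= 1 / 3 ->
  0 <= y <= 1 -> Nset q (q * y) <-> odd_Nset q y.
Proof.
move=> q0 q3; have q01 : 0 < q < 1 by lra.
move=> y01; have qy01 := mulr_itv (ltW q0) y01; rewrite NsetE /odd_Nset /= y01.
have qy : q * y / q = y by field; lra.
split=> -[_ h]; split=> //.
- by move=> n hn; apply: (h n); rewrite (cantor_removedS _ _ q0) qy; left.
- lra.
move=> n /(cantor_removedS _ _ q0); rewrite qy => -[|]; first exact: h.
by move=> /(cantor_removed_itv q01); rewrite ltr_pdivlMr// ltr_pdivrMr//; lra.
Qed.

Lemma Nset_right {R : realType} (q y : R) : 0 < q -> q <= 1 / 3 ->
  0 <= y <= 1 -> Nset q (1 - q + q * y) <-> odd_Nset q y.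
Proof.
move=> q0 q3; have q01 : 0 < q < 1 by lra.
move=> y01; have qy01 := mulr_itv (ltW q0) y01; rewrite NsetE /odd_Nset /= y01.
have qy : (1 - q + q * y - (1 - q)) / q = y by field; lra.
split=> -[_ h]; split=> //.
- by move=> n hn; apply: (h n); rewrite (cantor_removedS _ _ q0) qy; right.
- lra.
move=> n /(cantor_removedS _ _ q0); rewrite qy => -[|]; last exact: h.
by move=> /(cantor_removed_itv q01); rewrite ltr_pdivlMr// ltr_pdivrMr//; lra.
Qed.

(** Steps from the second on remove only points of the open intervals from [0] to [q] and from
    [1 - q] to [1]. *)
Lemma Nset_middle {R : realType} (q x : R) : 0 < q -> q <= 1 / 3 ->
  q <= x <= 1 - q -> Nset q x.
Proof.
move=> q0 q3; have q01 : 0 < q < 1 by lra.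
move=> xq; apply/NsetE; split; first lra.
by move=> n /(cantor_removedS _ _ q0)[] /(cantor_removed_itv q01);
  rewrite ltr_pdivlMr// ltr_pdivrMr//; lra.
Qed.

(** As for [Nset_left], except that step 1 has no predecessor: it removes only points above [q], so
    it does not affect [q * y]. *)
Lemma odd_Nset_left {R : realType} (q y : R) : 0 < q -> q <= 1 / 3 ->
  0 <= y <= 1 -> odd_Nset q (q * y) <-> Nset q y.
Proof.
move=> q0 q3; have q01 : 0 < q < 1 by lra.
move=> y01; have qy01 := mulr_itv (ltW q0) y01; rewrite NsetE /odd_Nset /= y01.
have qy : q * y / q = y by field; lra.
split=> -[_ h]; split=> //.
- move=> n hn; apply: (h n.+1); rewrite mulnS.
  by apply/(cantor_removedS _ _ q0); rewrite qy; left.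
- lra.
case=> [|n]; first by move=> /cantor_removed1; lra.
rewrite mulnS => /(cantor_removedS _ _ q0); rewrite qy => -[|]; first exact: h.
by move=> /(cantor_removed_itv q01); rewrite ltr_pdivlMr// ltr_pdivrMr//; lra.
Qed.

Lemma odd_Nset_right {R : realType} (q y : R) : 0 < q -> q <= 1 / 3 ->
  0 <= y <= 1 -> odd_Nset q (1 - q + q * y) <-> Nset q y.
Proof.
move=> q0 q3; have q01 : 0 < q < 1 by lra.
move=> y01; have qy01 := mulr_itv (ltW q0) y01; rewrite NsetE /odd_Nset /= y01.
have qy : (1 - q + q * y - (1 - q)) / q = y by field; lra.
split=> -[_ h]; split=> //.
- move=> n hn; apply: (h n.+1); rewrite mulnS.
  by apply/(cantor_removedS _ _ q0); rewrite qy; right.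
- lra.
case=> [|n]; first by move=> /cantor_removed1; lra.
rewrite mulnS => /(cantor_removedS _ _ q0); rewrite qy => -[|]; last exact: h.
by move=> /(cantor_removed_itv q01); rewrite ltr_pdivlMr// ltr_pdivrMr//; lra.
Qed.

Lemma Nset01 {R : realType} (q y : R) : Nset q y -> 0 <= y <= 1.
Proof. by case/NsetE. Qed.

Lemma odd_NsetP {R : realType} (q y : R) : 0 < q -> q <= 1 / 3 ->
  odd_Nset q y -> exists2 z, Nset q z & y = q * z \/ y = 1 - q + q * z.
Proof.
move=> q0 q3 yN; have [y01 /(_ 0%N)/cantor_removed1 yq] := yN.
have [yl|yr] : y <= q \/ 1 - q <= y.
  by have [|] := leP y q; [left|right]; lra.
- have yE : y = q * (y / q) by field; lra.
  exists (y / q); last by left.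
  apply/(odd_Nset_left q0 q3); last by rewrite -yE.
  by rewrite ler_pdivlMr// ler_pdivrMr//; lra.
- have yE : y = 1 - q + q * ((y - (1 - q)) / q) by field; lra.
  exists ((y - (1 - q)) / q); last by right.
  apply/(odd_Nset_right q0 q3); last by rewrite -yE.
  by rewrite ler_pdivlMr// ler_pdivrMr//; lra.
Qed.

(** Outside the solid interval, one passage to [odd_Nset] and one back give the factor [q ^+ 2]. The
    four values of [s] are the left ends of the intervals left after two steps. *)
Lemma NsetP {R : realType} (q x : R) : 0 < q -> q <= 1 / 3 ->
  Nset q x -> q <= x <= 1 - q \/
  exists2 z, Nset q z &
    exists2 s, s \in [:: 0; q - q ^+ 2; 1 - q; 1 - q ^+ 2] & x = q ^+ 2 * z + s.
Proof.
move=> q0 q3 xN; have x01 := Nset01 xN.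
have [xl|xl] := ltP x q.
  right; have xE : x = q * (x / q) by field; lra.
  have /(odd_NsetP q0 q3)[z zN zE] : odd_Nset q (x / q).
    apply/(Nset_left q0 q3); last by rewrite -xE.
    by rewrite ler_pdivlMr// ler_pdivrMr//; lra.
  exists z => //; rewrite xE; case: zE => ->.
    by exists 0; [rewrite !inE eqxx|ring].
  by exists (q - q ^+ 2); [rewrite !inE eqxx ?orbT|ring].
have [xr|xr] := ltP (1 - q) x; last by left; lra.
right; have xE : x = 1 - q + q * ((x - (1 - q)) / q) by field; lra.
have /(odd_NsetP q0 q3)[z zN zE] : odd_Nset q ((x - (1 - q)) / q).
  apply/(Nset_right q0 q3); last by rewrite -xE.
  by rewrite ler_pdivlMr// ler_pdivrMr//; lra.
exists z => //; rewrite xE; case: zE => ->.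
  by exists (1 - q); [rewrite !inE eqxx ?orbT|ring].
by exists (1 - q ^+ 2); [rewrite !inE eqxx ?orbT|ring].
Qed.

(** * Copies of [Nset] that stay inside it *)

Lemma Nset_corner {R : realType} (q s z : R) : 0 < q -> q <= 1 / 3 ->
  s \in [:: 0; q - q ^+ 2; 1 - q; 1 - q ^+ 2] ->
  Nset q z -> Nset q (q ^+ 2 * z + s).
Proof.
move=> q0 q3 sq zN; have z01 := Nset01 zN.
have qz01 := mulr_itv (ltW q0) z01.
have ql : 0 <= q * z <= 1 by lra.
have qr : 0 <= 1 - q + q * z <= 1 by lra.
move: sq; rewrite !inE => /or4P[] /eqP ->.
- rewrite [X in Nset q X](_ : _ = q * (q * z)); last by ring.
  by apply/(Nset_left q0 q3 ql)/(odd_Nset_left q0 q3).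
- rewrite [X in Nset q X](_ : _ = q * (1 - q + q * z)); last by ring.
  by apply/(Nset_left q0 q3 qr)/(odd_Nset_right q0 q3).
- rewrite [X in Nset q X](_ : _ = 1 - q + q * (q * z)); last by ring.
  by apply/(Nset_right q0 q3 ql)/(odd_Nset_left q0 q3).
- rewrite [X in Nset q X](_ : _ = 1 - q + q * (1 - q + q * z)); last by ring.
  by apply/(Nset_right q0 q3 qr)/(odd_Nset_right q0 q3).
Qed.

Lemma Nset_translation {R : realType} (q y : R) : 0 < q -> q <= 1 / 3 ->
  0 <= y <= 1 -> Nset q (q * y) <-> Nset q (1 - q + q * y).
Proof. by move=> q0 q3 y01; rewrite Nset_left// Nset_right. Qed.

(* The part of the copy that protrudes to the left of [q] is a scaled copy of
   the left end of [Nset q], which by translation is also its right end. *)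
Lemma Nset_first {R : realType} (q z : R) : 0 < q -> q <= 1 / 3 ->
  Nset q z -> Nset q (q ^+ 2 * z + (q - q ^+ 3)).
Proof.
move=> q0 q3 zN; have z01 := Nset01 zN.
have [q2 q3'] := expr23_itv q0 q3.
have q2z := mulr_itv (exprn_ge0 2 (ltW q0)) z01.
have [zq|qz] := leP z q; last first.
  apply: (Nset_middle q0 q3).
  by have := ler_wpM2l (exprn_ge0 2 (ltW q0)) (ltW qz); rewrite -exprSr; lra.
pose y := z / q.
have y01 : 0 <= y <= 1 by rewrite ler_pdivlMr// ler_pdivrMr//; lra.
have zE : z = q * y by rewrite /y; field; lra.
(* The protruding point lies in the corner copy that ends at [q], as the image of a point of the
   right end of [Nset q]. *)
rewrite [X in Nset q X](_ : _ = q ^+ 2 * (1 - q + q * y) + (q - q ^+ 2));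
  last by rewrite zE; ring.
apply: (Nset_corner q0 q3); first by rewrite !inE eqxx ?orbT.
by apply/(Nset_translation q0 q3); rewrite -?zE.
Qed.

(** Mirror image of [Nset_first]: the part that protrudes to the right of [1 - q] falls on the left
    end of the corner copy that starts there. *)
Lemma Nset_last {R : realType} (q z : R) : 0 < q -> q <= 1 / 3 ->
  Nset q z -> Nset q (q ^+ 2 * z + (1 - q - q ^+ 2 + q ^+ 3)).
Proof.
move=> q0 q3 zN; have z01 := Nset01 zN.
have [q2 q3'] := expr23_itv q0 q3.
have q2z := mulr_itv (exprn_ge0 2 (ltW q0)) z01.
have [zq|qz] := leP z (1 - q).
  by apply: (Nset_middle q0 q3); have := ler_wpM2l (exprn_ge0 2 (ltW q0)) zq;
    rewrite mulrBr -exprSr mulr1; lra.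
pose y := (z - (1 - q)) / q.
have y01 : 0 <= y <= 1 by rewrite ler_pdivlMr// ler_pdivrMr//; lra.
have zE : z = 1 - q + q * y by rewrite /y; field; lra.
rewrite [X in Nset q X](_ : _ = q ^+ 2 * (q * y) + (1 - q)); last first.
  by rewrite zE; ring.
apply: (Nset_corner q0 q3); first by rewrite !inE eqxx ?orbT.
by apply/(Nset_translation q0 q3); rewrite -?zE.
Qed.

Lemma Nset_inner {R : realType} (q s z : R) : 0 < q -> q <= 1 / 3 ->
  q <= s <= 1 - q - q ^+ 2 -> Nset q z -> Nset q (q ^+ 2 * z + s).
Proof.
move=> q0 q3 sq /Nset01 z01; apply: (Nset_middle q0 q3).
by have := mulr_itv (exprn_ge0 2 (ltW q0)) z01; lra.
Qed.

(** * Compactness, and uniqueness of invariant sets of affine systems *)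

Lemma compact_Nset {R : realType} (q : R) : compact (Nset q : set R^o).
Proof.
have -> : Nset q = `[0, 1] `&`
    ~` \bigcup_(n in [set n | (1 <= n)%N]) cantor_removed q (2 * n).
  by rewrite /Nset setDE; congr (_ `&` _); apply/seteqP; split=> x /=;
    rewrite in_itv.
apply: subclosed_compact (@segment_compact R 0 1) _; last exact: subIsetl.
apply: closedI; first exact: interval_closed.
apply: open_closedC; apply: bigcup_open => n _; apply: bigcup_open => J _.
by have := @interval_open R (BRight (middle (gap_length q (2 * n).-1) J).1)
  (BLeft (middle (gap_length q (2 * n).-1) J).2) isT isT;
  congr open; apply/seteqP; split=> x /=; rewrite in_itv.
Qed.

Lemma bigcup_affine_ifs {R : realType} (q : R) (Sigma : {fset R}) (D : set R) x :
  (\bigcup_(i < size (affine_ifs q Sigma)) (nth id (affine_ifs q Sigma) i @` D))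
    x <->
  exists2 s, s \in Sigma & exists2 z, D z & x = q ^+ 2 * z + s.
Proof.
rewrite /affine_ifs size_map; split=> [[i /= ilt [z Dz]]|[s sS [z Dz ->]]].
  rewrite (nth_map 0)// => <-; exists (enum_fset Sigma)`_i; last by exists z.
  exact: mem_nth.
exists (index s (enum_fset Sigma)); first by rewrite /= index_mem.
by exists z => //; rewrite (nth_map 0) ?index_mem// nth_index.
Qed.

Lemma is_ifs_affine {R : realType} (q : R) (Sigma : {fset R}) :
  0 < q < 1 -> is_ifs (affine_ifs q Sigma).
Proof.
move=> /andP[q0 q1] i; rewrite size_map => iS; exists (q ^+ 2).
  by rewrite exprn_ge0 ?ltW// exprn_ilt1 ?ltW.
move=> x y; rewrite (nth_map 0)//.
(* [mdist x y] on the line is [`|y - x|] by conversion. *)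
change (`|(q ^+ 2 * y + (enum_fset Sigma)`_i) -
          (q ^+ 2 * x + (enum_fset Sigma)`_i)| <= q ^+ 2 * `|y - x|).
rewrite [X in `|X|](_ : _ = q ^+ 2 * (y - x)); last by ring.
by rewrite normrM ger0_norm// exprn_ge0// ltW.
Qed.

(* Two invariant sets are at bounded distance from each other, and invariance
   shrinks this distance by the factor [q ^+ 2]. *)
Lemma invariant_affine_sub {R : realType} (q : R) (Sigma : {fset R})
    (D E : set R^o) : 0 < q < 1 ->
  ifs_invariant (affine_ifs q Sigma) D ->
  ifs_invariant (affine_ifs q Sigma) E ->
  D `<=` E.
Proof.
move=> /andP[q0 q1] [_ cD DE] [[e0 Ee0] cE EE] x Dx.
have k0 : 0 <= q ^+ 2 by rewrite exprn_ge0 ?ltW.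
have k1 : `|q ^+ 2| < 1 by rewrite ger0_norm// exprn_ilt1 ?ltW.
have bounded (F : set R^o) : compact F ->
    exists M : R, forall z, F z -> `|z| <= M.
  move=> /compact_bounded[M [_ FM]]; exists (M + 1) => z; apply: FM.
  by rewrite ltrDl.
have [M DM] := bounded _ cD; have [M' EM'] := bounded _ cE.
have near_E n : forall z, D z ->
    exists2 y, E y & `|z - y| <= (q ^+ 2) ^+ n * (M + M').
  elim: n => [|n IH] z Dz.
    exists e0 => //; rewrite expr0 mul1r (le_trans (ler_normB _ _))//.
    by rewrite lerD// ?DM// EM'.
  move: Dz; rewrite DE => /bigcup_affine_ifs[s sS [w Dw ->]].
  have [y Ey wy] := IH _ Dw; exists (q ^+ 2 * y + s).
    by rewrite EE; apply/bigcup_affine_ifs; exists s => //; exists y.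
  rewrite [X in `|X|](_ : _ = q ^+ 2 * (w - y)); last by ring.
  by rewrite normrM ger0_norm// (exprS _ n) -mulrA ler_wpM2l.
(* As [E] is closed, it suffices to find points of [E] in every neighbourhood of [x]. *)
have /closure_id -> : closed E := compact_closed (@Rhausdorff R) cE.
move=> B /nbhs_ballP[e /= e_gt0 Be].
have /cvgrPdist_lt/(_ e e_gt0)[N _ /(_ N (leqnn N))/=] :
    (q ^+ 2) ^+ n * (M + M') @[n --> \oo] --> (0 : R).
  by rewrite -[X in _ --> X](mul0r (M + M')); apply: cvgMl; exact: cvg_expr.
rewrite sub0r normrN => Ne; have [y Ey xy] := near_E N _ Dx; exists y.
split=> //; apply: Be; rewrite /ball /=.
by apply: le_lt_trans xy _; apply: le_lt_trans Ne; exact: ler_norm.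
Qed.

(** * The translations: count, inclusion and covering *)

(* Besides the four corner copies, translates whose solid middle parts have
   length [q ^+ 2 * (1 - 2 * q)]: [n] of them laid side by side from [q] on, and
   two laid side by side up to [1 - q].  Here [n.+2] is [ceil (1 / q ^+ 2)]. *)
Definition offsets {R : realType} (q : R) (n : nat) : seq R :=
  [:: 0; q - q ^+ 2] ++
  [seq q - q ^+ 3 + j%:R * (q ^+ 2 * (1 - 2 * q)) | j <- iota 0 n] ++
  [:: 1 - q - q ^+ 2 + q ^+ 3 - q ^+ 2 * (1 - 2 * q); 1 - q - q ^+ 2 + q ^+ 3;
      1 - q; 1 - q ^+ 2].

(** The inequality amounts to [q <= 1 - 2 * q], that is [q <= 1 / 3]. The expanded form lets [lra]
    treat [q ^+ 2] and [q ^+ 3] as atoms. *)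
Lemma middle_length_ge {R : realType} (q : R) : 0 < q -> q <= 1 / 3 ->
  q ^+ 3 <= q ^+ 2 * (1 - 2 * q) /\
  q ^+ 2 * (1 - 2 * q) = q ^+ 2 - 2 * q ^+ 3.
Proof.
move=> q0 q3; split; last by ring.
have [] := expr23_itv q0 q3.
have : q ^+ 3 = q ^+ 2 * q by rewrite -exprSr.
move: (q ^+ 3) => c -> q2 _; rewrite ler_pM2l; lra.
Qed.

(** Both bounds are the hypothesis multiplied by [1 - 2 * q]. After the [n] parts laid from [q] on,
    more than one length remains, which keeps the offsets distinct, and at most two, which the two
    parts laid up to [1 - q] cover. *)
Lemma offsets_left_length {R : realType} (q : R) (n : nat) :
  0 < q -> q <= 1 / 3 ->
  n.+1%:R * q ^+ 2 < 1 <= n.+2%:R * q ^+ 2 ->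
  n%:R * (q ^+ 2 * (1 - 2 * q)) < 1 - 2 * q - q ^+ 2 * (1 - 2 * q) /\
  1 - 2 * q - 2 * (q ^+ 2 * (1 - 2 * q)) <= n%:R * (q ^+ 2 * (1 - 2 * q)).
Proof.
move=> q0 q3; rewrite -[n.+2%:R]natr1 -[n.+1%:R]natr1.
move: (n%:R) => k /andP[lo hi]; have d0 : 0 < 1 - 2 * q by lra.
move: lo hi; rewrite -(ltr_pM2r d0) -(ler_pM2r d0) => lo hi; split; lra.
Qed.

Lemma offsets_left_itv {R : realType} (q : R) (n j : nat) :
  0 < q -> q <= 1 / 3 ->
  n.+1%:R * q ^+ 2 < 1 <= n.+2%:R * q ^+ 2 -> (j < n)%N ->
  q - q ^+ 3 <= q - q ^+ 3 + j%:R * (q ^+ 2 * (1 - 2 * q))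
    < 1 - q - q ^+ 2 + q ^+ 3 - q ^+ 2 * (1 - 2 * q).
Proof.
move=> q0 q3 nq jn; have [lo _] := offsets_left_length q0 q3 nq.
have [q2 q3'] := expr23_itv q0 q3; have [ge_s sE] := middle_length_ge q0 q3.
have s0 : 0 < q ^+ 2 * (1 - 2 * q) by lra.
have j0 : 0 <= j%:R * (q ^+ 2 * (1 - 2 * q)) by rewrite mulr_ge0 ?ler0n// ltW.
have : j.+1%:R * (q ^+ 2 * (1 - 2 * q)) <= n%:R * (q ^+ 2 * (1 - 2 * q)).
  by rewrite ler_pM2r// ler_nat.
by rewrite -natr1 mulrDl mul1r; lra.
Qed.

Lemma offsets_uniq {R : realType} (q : R) (n : nat) : 0 < q -> q <= 1 / 3 ->
  n.+1%:R * q ^+ 2 < 1 <= n.+2%:R * q ^+ 2 -> uniq (offsets q n).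
Proof.
move=> q0 q3 nq.
have [q2 q3'] := expr23_itv q0 q3; have [ge_s sE] := middle_length_ge q0 q3.
have s0 : 0 < q ^+ 2 * (1 - 2 * q) by lra.
have inside x : x \in [seq q - q ^+ 3 + j%:R * (q ^+ 2 * (1 - 2 * q))
                       | j <- iota 0 n] ->
    q - q ^+ 3 <= x < 1 - q - q ^+ 2 + q ^+ 3 - q ^+ 2 * (1 - 2 * q).
  by move=> /mapP[j]; rewrite mem_iota => /andP[_ jn] ->;
    exact: (offsets_left_itv q0 q3 nq jn).
have injL : uniq [seq q - q ^+ 3 + j%:R * (q ^+ 2 * (1 - 2 * q))
                 | j <- iota 0 n].
  rewrite map_inj_uniq ?iota_uniq// => i j.
  by move=> /addrI/(mulIf (lt0r_neq0 s0))/eqP; rewrite eqr_nat => /eqP.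
have [lo _] := offsets_left_length q0 q3 nq.
have n0 : 0 <= n%:R * (q ^+ 2 * (1 - 2 * q)) by rewrite mulr_ge0 ?ler0n// ltW.
(* With the progression moved to the front, the six other offsets are increasing, and [inside]
   excludes each of them from the progression. *)
rewrite /offsets uniq_catCA cat_uniq injL /= !(inE, negb_or) /= !andbT.
by repeat (apply/andP; split); try (by apply/negP => /inside; lra);
  rewrite lt_eqF//; lra.
Qed.

Lemma Nset_offsets {R : realType} (q s z : R) (n : nat) : 0 < q -> q <= 1 / 3 ->
  n.+1%:R * q ^+ 2 < 1 <= n.+2%:R * q ^+ 2 ->
  s \in offsets q n -> Nset q z -> Nset q (q ^+ 2 * z + s).
Proof.
move=> q0 q3 nq.
have [q2 q3'] := expr23_itv q0 q3; have [ge_s sE] := middle_length_ge q0 q3.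
have corner t : t \in [:: 0; q - q ^+ 2; 1 - q; 1 - q ^+ 2] ->
    Nset q z -> Nset q (q ^+ 2 * z + t) by exact: Nset_corner.
rewrite /offsets !mem_cat => /or3P[]; last first.
- rewrite !inE => /or4P[]/eqP->; first by apply: Nset_inner => //; lra.
  + exact: Nset_last.
  + by apply: corner; rewrite !inE eqxx ?orbT.
  + by apply: corner; rewrite !inE eqxx ?orbT.
- move=> /mapP[j]; rewrite mem_iota => /andP[_ jn] ->.
  (* Only [j = 0] protrudes to the left of [q]: for [j >= 1] the offset has moved right by at least
     one middle length, hence by at least [q ^+ 3]. *)
  have [->|j0] := eqVneq j 0%N; first by rewrite mul0r addr0; exact: Nset_first.
  apply: Nset_inner => //; have := offsets_left_itv q0 q3 nq jn.
  have : 1%:R * (q ^+ 2 * (1 - 2 * q)) <= j%:R * (q ^+ 2 * (1 - 2 * q)).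
    by rewrite ler_pM2r ?ler_nat ?lt0n//; lra.
  by rewrite mul1r; lra.
- by rewrite !inE => /orP[]/eqP->; apply: corner; rewrite !inE eqxx ?orbT.
Qed.

(** The bounds on [x] are the ends of the solid middle part of the copy with offset [s]. *)
Lemma offsets_cover {R : realType} (q x : R) (n : nat) : 0 < q -> q <= 1 / 3 ->
  n.+1%:R * q ^+ 2 < 1 <= n.+2%:R * q ^+ 2 -> q <= x <= 1 - q ->
  exists2 s, s \in offsets q n & s + q ^+ 3 <= x <= s + q ^+ 2 - q ^+ 3.
Proof.
move=> q0 q3 nq xq; have [_ hi] := offsets_left_length q0 q3 nq.
have [q2 q3'] := expr23_itv q0 q3; have [ge_s sE] := middle_length_ge q0 q3.
set s := q ^+ 2 * (1 - 2 * q) in hi ge_s sE *.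
have s0 : 0 < s by lra.
have [xl|xr] := leP (1 - q - q ^+ 2 + q ^+ 3 - s + q ^+ 3) x.
  have [xl'|xr'] := leP (1 - q - q ^+ 2 + q ^+ 3 + q ^+ 3) x.
    exists (1 - q - q ^+ 2 + q ^+ 3); last lra.
    by rewrite /offsets !mem_cat !inE eqxx !orbT.
  exists (1 - q - q ^+ 2 + q ^+ 3 - s); last lra.
  by rewrite /offsets !mem_cat !inE eqxx !orbT.
(* The part containing [x] is found by counting the whole lengths [s] between [q] and [x]. The bound
   [xr] says [x < 1 - q - 2 * s], so this count is below [n]. *)
have x0 : 0 <= (x - q) / s by apply: divr_ge0; lra.
have := truncn_itv x0; set j := Num.truncn _ => /andP[].
rewrite ler_pdivlMr// ltr_pdivrMr// -natr1 mulrDl mul1r => jl jr.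
exists (q - q ^+ 3 + j%:R * s); last lra.
rewrite /offsets !mem_cat; apply/or3P/Or32/mapP; exists j => //.
rewrite mem_iota /= add0n -(ltr_nat R) -(ltr_pM2r s0); lra.
Qed.

Theorem theorem11 (R : realType) (q : R) (hq : 0 < q <= 1 / 3) :
  exists Sigma : {fset R},
    [/\ (#|` Sigma|)%:Z = 4 + Num.ceil (1 / q ^+ 2),
        is_ifs (affine_ifs q Sigma) &
        is_attractor (affine_ifs q Sigma) (Nset q)].
Proof.
have [q0 q3] := andP hq; have q01 : 0 < q < 1 by lra.
have [q2 q3'] := expr23_itv q0 q3; have q2_gt0 : 0 < q ^+ 2 by lra.
(* Writing the ceiling as [n.+2] sets apart the two copies aligned with [1 - q]; it is at least 2
   because [q ^+ 2 <= q / 3]. *)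
have [n nE nq] : exists2 n : nat, Num.ceil (1 / q ^+ 2) = n.+2%:Z &
    n.+1%:R * q ^+ 2 < 1 <= n.+2%:R * q ^+ 2.
  have := ceil_itv (1 / q ^+ 2); set c := Num.ceil _ => c_itv.
  have c2 : 2 <= c.
    rewrite -(ler_int R); apply: le_trans (andP c_itv).2.
    by rewrite ler_pdivlMr//; lra.
  case: c c2 c_itv => [[|[|n]]|]// _; exists n => //; move: c_itv.
  by rewrite ltr_pdivlMr// ler_pdivrMr// rmorphB /= -[n.+2%:~R]natr1 addrK.
pose Sigma := seq_fset tt (offsets q n).
have SigmaE s : (s \in Sigma) = (s \in offsets q n) by exact: seq_fsetE.
exists Sigma; split.
- rewrite size_seq_fset undup_id ?offsets_uniq// nE.
  by rewrite /offsets !size_cat size_map size_iota /=; lia.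
- exact: is_ifs_affine.
- suff NI : ifs_invariant (affine_ifs q Sigma) (Nset q).
    split=> // D DI; apply/seteqP; split.
      exact: invariant_affine_sub DI NI.
    exact: invariant_affine_sub NI DI.
  split; [|exact: compact_Nset|].
    by exists q; apply: Nset_middle => //; lra.
  apply/seteqP; split=> x.
    move=> /(NsetP q0 q3)[xq|[z zN [s sq ->]]]; apply/bigcup_affine_ifs.
      have [s sS sx] := offsets_cover q0 q3 nq xq; exists s.
        by rewrite SigmaE.
      (* The preimage of [x] lies between [q] and [1 - q], hence in [Nset q]. *)
      exists ((x - s) / q ^+ 2); last by field; lra.
      apply: Nset_middle => //; rewrite ler_pdivlMr// ler_pdivrMr//.
      by rewrite mulrBl mul1r -exprS; lra.
    exists s; last by exists z.
    move: sq; rewrite SigmaE /offsets !mem_cat !inE.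
    by move=> /or4P[]/eqP->; rewrite eqxx ?orbT.
  move=> /bigcup_affine_ifs[s sS [z zN ->]].
  by apply: (Nset_offsets q0 q3 nq) => //; rewrite -SigmaE.
Qed.
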